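(* Every $8$-dimensional complex filiform Lie algebra which is both symplectic and characteristically nilpotent is isomorphic to one of the following laws: $\mu_0+\alpha\psi_{2,5}+\psi_{3,7}+\psi_{3,8}$ with $\alpha\in\mathbb{C}$, $\alpha\neq -\frac12,0,1,\frac52$; or $\mu_0+\alpha\psi_{2,6}+\psi_{2,7}+\psi_{3,8}$ with $\alpha\in\mathbb{C}$; or $\mu_0+\psi_{2,7}+\psi_{2,8}$; or $\mu_0+\psi_{2,6}+\psi_{2,7}$.
   Context: For a Lie algebra $\mathfrak{g}$ put $\mathfrak{g}^0=\mathfrak{g}$, $\mathfrak{g}^j=[\mathfrak{g}^{j-1},\mathfrak{g}]$. A nilpotent Lie algebra of dimension $n$ is filiform if $\mathfrak{g}^{n-1}=0$ and $\mathfrak{g}^{n-2}\neq 0$. A Lie algebra is symplectic if it admits a nondegenerate skew-symmetric bilinear form $\omega$ with $\omega([x,y],z)-\omega([x,z],y)+\omega([y,z],x)=0$ for all $x,y,z$. A characteristically nilpotent Lie algebra (CNLA) is one all of whose derivations are nilpotent. Notation for laws ($n=8$): let $\mathcal{I}_8=\{(k,s): 2\le k\le 4,\ 2k+1\le s\le 8\}\cup\{(4,8)\}$. For constants $\alpha_{k,s}\in\mathbb{C}$, $(k,s)\in\mathcal{I}_8$ (and $\alpha_{k,s}=0$ for $(k,s)\notin\mathcal{I}_8$), the law $\mu_0+\sum_{(k,s)\in\mathcal{I}_8}\alpha_{k,s}\psi_{k,s}$ is the bracket on the vector space with basis $e_1,\dots,e_8$ given by $[e_1,e_i]=e_{i+1}$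 for $2\le i\le 7$, $[e_1,e_8]=0$, and $$[e_i,e_j]=\sum_{r=1}^{8}\Bigl(\sum_{\ell=0}^{\lfloor (j-i-1)/2\rfloor}(-1)^\ell\binom{j-i-\ell-1}{\ell}\alpha_{i+\ell,\,r-j+i+2\ell+1}\Bigr)e_r,\qquad 2\le i<j\le 8.$$ In particular $\mu_0$ denotes the law with all $\alpha_{k,s}=0$. *)

(* Defs.v *)
From HB Require Import structures.
From mathcomp Require Import all_boot all_order all_algebra.
From mathcomp Require Import sesquilinear.

Set Implicit Arguments.
Unset Strict Implicit.
Unset Printing Implicit Defensive.

Import GRing.Theory.
Local Open Scope ring_scope.

Section LieAlgebras.
Variables (F : fieldType) (V : vectType F).
Implicit Types (br : {bilinear V -> V -> V}) (U W : {vspace V}).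

Definition is_lie_bracket br : Prop :=
  (forall x, br x x = 0) /\
  (forall x y z, br x (br y z) + br y (br z x) + br z (br x y) = 0).

(* The span of all [u, w] with u in U and w in W, see memv_lie_prod and
   lie_prod_subP. *)
Definition lie_prod br U W : {vspace V} :=
  <<[seq br u w | u <- vbasis U, w <- vbasis W]>>%VS.

Lemma memv_lie_prod br U W u w :
  u \in U -> w \in W -> br u w \in lie_prod br U W.
Proof.
move=> uU wW; rewrite (coord_vbasis uU) (coord_vbasis wW).
rewrite linear_sumlz; apply: memv_suml => i _.
rewrite linear_sumr; apply: memv_suml => j _.
rewrite linearZl_LR linearZr_LR /=; do 2!apply: memvZ; apply: memv_span.
by apply: allpairs_f; apply: mem_nth; rewrite size_tuple.
Qed.

Lemma lie_prod_subP br U W (X : {vspace V}) :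
  reflect (forall u w, u \in U -> w \in W -> br u w \in X)
          (lie_prod br U W <= X)%VS.
Proof.
apply: (iffP idP) => [sX u w uU wW | inX].
  exact: subvP sX _ (memv_lie_prod br uU wW).
apply/span_subvP => _ /allpairsP[[u w] [/= /vbasis_mem uU /vbasis_mem wW ->]].
exact: inX.
Qed.

Fixpoint lower_central br (j : nat) : {vspace V} :=
  if j is j'.+1 then lie_prod br (lower_central br j') fullv else fullv.

Definition nilpotent_lie br : Prop :=
  exists j, lower_central br j = 0%VS.

Definition filiform br : Prop :=
  let n := \dim {:V} in
  [/\ nilpotent_lie br,
      lower_central br n.-1 = 0%VS &
      lower_central br n.-2 <> 0%VS].

Definition symplectic br : Prop :=
  exists w : {biscalar V},
    [/\ forall x y, w x y = - w y x,
        forall x, (forall y, w x y = 0) -> x = 0 &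
        forall x y z, w (br x y) z - w (br x z) y + w (br y z) x = 0].

Definition derivation br (D : 'End(V)) : Prop :=
  forall x y, D (br x y) = br (D x) y + br x (D y).

Definition nilpotent_endo (D : 'End(V)) : Prop :=
  exists k, forall x, iter k D x = 0.

Definition characteristically_nilpotent br : Prop :=
  forall D : 'End(V), derivation br D -> nilpotent_endo D.

End LieAlgebras.

(* The target operation need not be known to be a Lie bracket: being
   isomorphic to a Lie bracket makes it one. *)
Definition law_isomorphic (F : fieldType) (V W : vectType F)
    (brV : V -> V -> V) (brW : W -> W -> W) : Prop :=
  exists f : 'Hom(V, W),
    bijective f /\ (forall x y, f (brV x y) = brW (f x) (f y)).

Section Laws.
Variable F : fieldType.
Implicit Type alpha : nat -> nat -> F.

Definition index8 (k s : nat) : bool :=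
  [&& 2 <= k, k <= 4, 2 * k + 1 <= s & s <= 8]%N || ((k == 4) && (s == 8))%N.

Definition coef8 alpha (k s : nat) : F :=
  if index8 k s then alpha k s else 0.

(* Coefficient of e_r in [e_i, e_j] for 1 <= i < j <= 8 and 1 <= r <= 8, the
   labels being 1-based.  A second index r - j + i + 2l + 1 <= 0 is truncated
   to 0, and coef8 vanishes there as well. *)
Definition struct8 alpha (i j r : nat) : F :=
  if i == 1%N then (r == j.+1)%:R
  else \sum_(0 <= l < ((j - i - 1) %/ 2).+1)
         (-1) ^+ l * 'C(j - i - l - 1, l)%:R
           * coef8 alpha (i + l)%N (r + i + 2 * l + 1 - j)%N.

(* mu_0 + sum_(k, s) alpha_(k, s) psi_(k, s), extended to all pairs of vectors
   by bilinearity and antisymmetry; coordinate i : 'I_8 is that of e_(i + 1). *)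
Definition law8 alpha (x y : 'rV[F]_8) : 'rV[F]_8 :=
  \row_r \sum_(i < 8) \sum_(j < 8 | (i < j)%N)
    (x 0 i * y 0 j - x 0 j * y 0 i) * struct8 alpha i.+1 j.+1 r.+1.

(* The coefficient family of psi_(k, s). *)
Definition psi (k s : nat) : nat -> nat -> F :=
  fun k' s' => ((k' == k) && (s' == s))%:R.

End Laws.

Arguments psi {F} k s k' s'.

(* Main.v *)
(* The lower central series of a filiform algebra drops by one dimension at each
   step, so a generic e_1 and a suitable e_2 give a basis e_(i + 1) = [e_1, e_i]
   in which the bracket is determined by [e_2, e_3], [e_3, e_4] and [e_4, e_5];
   in dimension 8 this leaves the parameters a_s = alpha_(2, s),
   b_s = alpha_(3, s) and c = alpha_(4, 8).  Closedness of the symplectic form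
   forces c = 0, and nondegeneracy produces a scalar t with
   t (2 a_5 + b_7) = 3 b_7^2 and t <> 0, b_7, 3 b_7 - a_5, which excludes
   a_5 / b_7 = -1/2, 0, 1, 5/2 when b_7 <> 0 and forces a_5 = 0 when b_7 = 0.
   The base changes e_1 + q e_2 and e_2 + u e_4 + v e_5 kill all but at most three
   parameters.  If those left have the same weight, the algebra is graded and the
   grading is a derivation that is not nilpotent; otherwise rescaling e_1 and e_2
   reaches one of the listed laws. *)

Require Import Defs.
From mathcomp Require Import all_boot all_order all_algebra.
From mathcomp Require Import sesquilinear.
From mathcomp Require Import reals complex.
From mathcomp Require Import ring zify.

Set Implicit Arguments.
Unset Strict Implicit.
Unset Printing Implicit Defensive.

Import GRing.Theory Num.Theory.
Local Open Scope ring_scope.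

(* [ring] only accepts hypotheses whose left-hand side is a monomial. *)
Lemma lincomb (R : comPzRingType) (k a b l r : R) :
  l = r -> a - b = k * (l - r) -> a = b.
Proof. by move=> ->; rewrite subrr mulr0 => /eqP; rewrite subr_eq0 => /eqP. Qed.

Arguments lincomb {R} k {a b l r} _ _.

(** * Bases generated by two vectors, and coordinates in them *)

Section AdaptedBases.
Variables (F : numFieldType) (V : vectType F) (br : {bilinear V -> V -> V}).
Hypothesis dimV : \dim {:V} = 8%N.
Hypothesis lie : is_lie_bracket br.

Let brE := (linearDl, linearDr, linearZl_LR, linearZr_LR).

Lemma br_alt u : br u u = 0. Proof. by case: lie. Qed.

Lemma br_anti u v : br v u = - br u v.
Proof.
apply/eqP; rewrite -addr_eq0; apply/eqP; have := br_alt (u + v).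
by rewrite !linearDl !linearDr !br_alt add0r addr0 addrC.
Qed.

Lemma br_leibniz u v w : br u (br v w) = br (br u v) w + br v (br u w).
Proof.
have [_ /(_ u v w)] := lie.
rewrite (br_anti (br u v)) (br_anti u w) linearNr => /eqP.
by rewrite -addrA addr_eq0 opprD !opprK addrC => /eqP.
Qed.

(* [chain x y i] is e_i for i >= 1, built from e_1 = x and e_2 = y; the index 0
   is junk. *)
Definition chain (x y : V) (i : nat) : V :=
  if i is i'.+2 then iter i' (br x) y else x.

(** Coordinates are explicit arguments, so that an identity between vectors reduces to eight scalar
    identities for [ring]. *)
Definition lc x y (c1 c2 c3 c4 c5 c6 c7 c8 : F) : V :=
  c1 *: chain x y 1 + (c2 *: chain x y 2 + (c3 *: chain x y 3 +
  (c4 *: chain x y 4 + (c5 *: chain x y 5 + (c6 *: chain x y 6 +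
  (c7 *: chain x y 7 + c8 *: chain x y 8)))))).

Lemma lcD x y c1 c2 c3 c4 c5 c6 c7 c8 d1 d2 d3 d4 d5 d6 d7 d8 :
  lc x y c1 c2 c3 c4 c5 c6 c7 c8 + lc x y d1 d2 d3 d4 d5 d6 d7 d8 =
  lc x y (c1 + d1) (c2 + d2) (c3 + d3) (c4 + d4)
         (c5 + d5) (c6 + d6) (c7 + d7) (c8 + d8).
Proof. by rewrite /lc !scalerDl; do 7!(rewrite addrACA; congr (_ + _)). Qed.

Lemma lcZ x y a c1 c2 c3 c4 c5 c6 c7 c8 :
  a *: lc x y c1 c2 c3 c4 c5 c6 c7 c8 =
  lc x y (a * c1) (a * c2) (a * c3) (a * c4) (a * c5) (a * c6) (a * c7) (a * c8).
Proof. by rewrite /lc !scalerDr !scalerA. Qed.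

(** Three brackets suffice: those with e_1 hold by the definition of [chain], and the others follow
    from [br_chainS] and the centrality of e_8. Linear independence follows as well, see
    [lc_eq0]. *)
Record adapted (x y : V) (a5 a6 a7 a8 b7 b8 c : F) : Prop := Adapted {
  chain8_neq0 : chain x y 8 != 0;
  br_chain8 : forall v, br v (chain x y 8) = 0;
  br_chain23 : br y (chain x y 3) = lc x y 0 0 0 0 a5 a6 a7 a8;
  br_chain34 : br (chain x y 3) (chain x y 4) = lc x y 0 0 0 0 0 0 b7 b8;
  br_chain45 : br (chain x y 4) (chain x y 5) = lc x y 0 0 0 0 0 0 0 c }.

Lemma br1_lc x y : (forall v, br v (chain x y 8) = 0) ->
  forall c1 c2 c3 c4 c5 c6 c7 c8,
  br x (lc x y c1 c2 c3 c4 c5 c6 c7 c8) = lc x y 0 0 c2 c3 c4 c5 c6 c7.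
Proof.
move=> br8 *; rewrite /lc !brE br8 br_alt !scaler0 addr0 !scale0r !add0r //.
Qed.

(** Powers of ad e_1 shift the coordinates towards e_8, which isolates c2, c3, ..., c7 one after the
    other. *)
Lemma lc_eq0 x y : chain x y 8 != 0 -> (forall v, br v (chain x y 8) = 0) ->
  forall c1 c2 c3 c4 c5 c6 c7 c8, lc x y c1 c2 c3 c4 c5 c6 c7 c8 = 0 ->
  [/\ c1 = 0, c2 = 0, c3 = 0 & c4 = 0] /\ [/\ c5 = 0, c6 = 0, c7 = 0 & c8 = 0].
Proof.
move=> nz8 br8.
have top c : lc x y 0 0 0 0 0 0 0 c = 0 -> c = 0.
  rewrite /lc !scale0r !add0r => /eqP.
  by rewrite scaler_eq0 (negPf nz8) orbF => /eqP.
move=> c1 c2 c3 c4 c5 c6 c7 c8 eq0.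
pose ad := br x.
have iter0 n : iter n ad 0 = 0 by elim: n => //= n ->; rewrite /ad linear0r.
have c2_0 : c2 = 0.
  by apply: top; move: (congr1 (iter 6 ad) eq0); rewrite iter0 /= /ad !(br1_lc br8).
have c3_0 : c3 = 0.
  by apply: top; move: (congr1 (iter 5 ad) eq0); rewrite iter0 /= /ad !(br1_lc br8) c2_0.
have c4_0 : c4 = 0.
  by apply: top; move: (congr1 (iter 4 ad) eq0);
    rewrite iter0 /= /ad !(br1_lc br8) c2_0 c3_0.
have c5_0 : c5 = 0.
  by apply: top; move: (congr1 (iter 3 ad) eq0);
    rewrite iter0 /= /ad !(br1_lc br8) c2_0 c3_0 c4_0.
have c6_0 : c6 = 0.
  by apply: top; move: (congr1 (iter 2 ad) eq0);
    rewrite iter0 /= /ad !(br1_lc br8) c2_0 c3_0 c4_0 c5_0.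
have c7_0 : c7 = 0.
  by apply: top; move: (congr1 ad eq0);
    rewrite /ad linear0r !(br1_lc br8) c2_0 c3_0 c4_0 c5_0 c6_0.
have c1_0 : c1 = 0.
  move: eq0; rewrite /lc c2_0 c3_0 c4_0 c5_0 c6_0 c7_0 !scale0r !add0r.
  (* ad e_1 does not see c1, so bracket with e_2 first: this yields c1 e_3, which five more shifts
     take to c1 e_8. *)
  move=> /(congr1 (br^~ y)); rewrite linear0l !brE.
  rewrite (br_anti y (chain x y 8)) br8 oppr0 scaler0 addr0.
  move=> /(congr1 (iter 5 ad)); rewrite iter0 /= /ad !linearZr_LR => /eqP.
  by rewrite scaler_eq0 (negPf nz8) orbF => /eqP.
split; split=> //; apply: top; by move: eq0; rewrite c1_0 c2_0 c3_0 c4_0 c5_0 c6_0 c7_0.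
Qed.

Definition chain_tuple x y : 8.-tuple V := [tuple chain x y i.+1 | i < 8].

Lemma sum_chain x y (k : 'I_8 -> F) :
  \sum_(i < 8) k i *: (chain_tuple x y)`_i =
  lc x y (k (inord 0)) (k (inord 1)) (k (inord 2)) (k (inord 3))
         (k (inord 4)) (k (inord 5)) (k (inord 6)) (k (inord 7)).
Proof.
rewrite (eq_bigr (fun i : 'I_8 => k (inord i) *: chain x y i.+1)) => [|i _].
  by rewrite !big_ord_recl big_ord0 addr0 /lc.
by rewrite inord_val -tnth_nth tnth_mktuple.
Qed.

Lemma chain_basis x y : chain x y 8 != 0 -> (forall v, br v (chain x y 8) = 0) ->
  basis_of fullv (chain_tuple x y).
Proof.
move=> nz8 br8; rewrite basisEfree subvf size_tuple dimV leqnn !andbT.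
apply/freeP => k; rewrite sum_chain => /(lc_eq0 nz8 br8) [[? ? ? ?] [? ? ? ?]] i.
rewrite -(inord_val i); case: i; by do 8!(case=> //).
Qed.

Lemma lc_surj x y : chain x y 8 != 0 -> (forall v, br v (chain x y 8) = 0) ->
  forall v, exists c1 c2 c3 c4 c5 c6 c7 c8, v = lc x y c1 c2 c3 c4 c5 c6 c7 c8.
Proof.
move=> nz8 br8 v.
rewrite (coord_basis (chain_basis nz8 br8) (memvf v)) sum_chain.
by do 8!eexists; reflexivity.
Qed.

Lemma lcB x y c1 c2 c3 c4 c5 c6 c7 c8 d1 d2 d3 d4 d5 d6 d7 d8 :
  lc x y c1 c2 c3 c4 c5 c6 c7 c8 - lc x y d1 d2 d3 d4 d5 d6 d7 d8 =
  lc x y (c1 - d1) (c2 - d2) (c3 - d3) (c4 - d4)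
         (c5 - d5) (c6 - d6) (c7 - d7) (c8 - d8).
Proof. by rewrite -scaleN1r lcZ lcD !mulN1r. Qed.

Lemma lc0 x y : lc x y 0 0 0 0 0 0 0 0 = 0.
Proof. by rewrite /lc !scale0r !addr0. Qed.

(** ad e_1 is a derivation. Both indices exceed 1 because e_2 is not [e_1, e_1]. *)
Lemma br_chainS x y i j : (1 < i)%N -> (1 < j)%N ->
  br (chain x y i) (chain x y j.+1) =
  br x (br (chain x y i) (chain x y j)) - br (chain x y i.+1) (chain x y j).
Proof.
have chainS k : (1 < k)%N -> chain x y k.+1 = br x (chain x y k).
  by case: k => [|[|k]].
by move=> i1 j1; rewrite !chainS // (br_leibniz x (chain x y i)) addrC addKr.
Qed.

(** * The multiplication table of an adapted basis *)

Section Table.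
Variables (x y : V) (a5 a6 a7 a8 b7 b8 c : F).
Hypothesis ad : adapted x y a5 a6 a7 a8 b7 b8 c.
Local Notation E := (chain x y).
Local Notation L := (lc x y).

Let br1 := br1_lc (br_chain8 ad).
Let br8 := br_chain8 ad.
Let simp := (subr0, sub0r, oppr0).

Lemma br_chain24 : br (E 2) (E 4) = L 0 0 0 0 0 a5 a6 a7.
Proof. by rewrite br_chainS // (br_chain23 ad) br1 br_alt subr0. Qed.

Lemma br_chain25 : br (E 2) (E 5) = L 0 0 0 0 0 0 (a5 - b7) (a6 - b8).
Proof. by rewrite br_chainS // br_chain24 br1 (br_chain34 ad) lcB !simp. Qed.

Lemma br_chain35 : br (E 3) (E 5) = L 0 0 0 0 0 0 0 b7.
Proof. by rewrite br_chainS // (br_chain34 ad) br1 br_alt subr0. Qed.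

Lemma br_chain26 : br (E 2) (E 6) = L 0 0 0 0 0 0 0 (a5 - 2 * b7).
Proof.
rewrite br_chainS // br_chain25 br1 br_chain35 lcB !simp.
by congr lc; ring.
Qed.

Lemma br_chain46 : br (E 4) (E 6) = 0.
Proof. by rewrite br_chainS // (br_chain45 ad) br1 br_alt subr0 lc0. Qed.

Lemma br_chain36 : br (E 3) (E 6) = L 0 0 0 0 0 0 0 (- c).
Proof. by rewrite br_chainS // br_chain35 br1 (br_chain45 ad) lcB !simp. Qed.

Lemma br_chain27 : br (E 2) (E 7) = L 0 0 0 0 0 0 0 c.
Proof. by rewrite br_chainS // br_chain26 br1 br_chain36 lcB !simp opprK. Qed.

Lemma br_chain37 : br (E 3) (E 7) = 0.
Proof. by rewrite br_chainS // br_chain36 br1 br_chain46 lc0 subr0. Qed.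

(** The recursion [br_chainS] is solved for its last term, starting from [e_3, e_8] = 0;
    [br_chain56] and [br_chain67] work in the same way. *)
Lemma br_chain47 : br (E 4) (E 7) = 0.
Proof.
have := @br_chainS x y 3 7 isT isT.
rewrite br8 br_chain37 linear0r sub0r => /esym /eqP.
by rewrite oppr_eq0 => /eqP.
Qed.

Lemma br_chain56 : br (E 5) (E 6) = 0.
Proof.
have := @br_chainS x y 4 6 isT isT.
rewrite br_chain47 br_chain46 linear0r sub0r => /esym /eqP.
by rewrite oppr_eq0 => /eqP.
Qed.

Lemma br_chain57 : br (E 5) (E 7) = 0.
Proof. by rewrite br_chainS // br_chain56 br_alt linear0r subr0. Qed.

Lemma br_chain67 : br (E 6) (E 7) = 0.
Proof.
have := @br_chainS x y 5 7 isT isT.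
rewrite br8 br_chain57 linear0r sub0r => /esym /eqP.
by rewrite oppr_eq0 => /eqP.
Qed.

Let br8l v : br (E 8) v = 0. Proof. by rewrite br_anti br8 oppr0. Qed.

Let table := (br8, br8l, br_alt, br_chain24, br_chain25, br_chain26, br_chain27,
  br_chain34 ad, br_chain35, br_chain36, br_chain37, br_chain45 ad, br_chain46,
  br_chain47, br_chain56, br_chain57, br_chain67).

Let br_E2 d1 d2 d3 d4 d5 d6 d7 d8 : br (E 2) (L d1 d2 d3 d4 d5 d6 d7 d8) =
  L 0 0 (- d1) 0 (a5 * d3) (a6 * d3 + a5 * d4)
    (a7 * d3 + a6 * d4 + (a5 - b7) * d5)
    (a8 * d3 + a7 * d4 + (a6 - b8) * d5 + (a5 - 2 * b7) * d6 + c * d7).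
Proof.
rewrite [X in br _ X]/lc !brE (br_anti (E 1) (E 2)).
have -> : br (E 1) (E 2) = L 0 0 1 0 0 0 0 0.
  by rewrite /lc !scale0r !add0r ?addr0 scale1r.
(* Signs and zeros are first written through [lc], so that the whole sum collects into a single
   [lc]. *)
rewrite (br_chain23 ad : br (E 2) (E 3) = _) !table -scaleN1r -(lc0 x y) !(lcZ, lcD).
by congr lc; ring.
Qed.

Let br_E3 d1 d2 d3 d4 d5 d6 d7 d8 : br (E 3) (L d1 d2 d3 d4 d5 d6 d7 d8) =
  L 0 0 0 (- d1) (- a5 * d2) (- a6 * d2) (- a7 * d2 + b7 * d4)
    (- a8 * d2 + b8 * d4 + b7 * d5 - c * d6).
Proof.
rewrite [X in br _ X]/lc !brE (br_anti (E 1) (E 3)) (br_anti (E 2) (E 3)).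
have -> : br (E 1) (E 3) = L 0 0 0 1 0 0 0 0.
  by rewrite /lc !scale0r !add0r ?addr0 scale1r.
rewrite (br_chain23 ad : br (E 2) (E 3) = _) !table -!scaleN1r -(lc0 x y) !(lcZ, lcD).
by congr lc; ring.
Qed.

Let br_E4 d1 d2 d3 d4 d5 d6 d7 d8 : br (E 4) (L d1 d2 d3 d4 d5 d6 d7 d8) =
  L 0 0 0 0 (- d1) (- a5 * d2) (- a6 * d2 - b7 * d3)
    (- a7 * d2 - b8 * d3 + c * d5).
Proof.
rewrite [X in br _ X]/lc !brE (br_anti (E 1) (E 4)) (br_anti (E 2) (E 4)).
rewrite (br_anti (E 3) (E 4)).
have -> : br (E 1) (E 4) = L 0 0 0 0 1 0 0 0.
  by rewrite /lc !scale0r !add0r ?addr0 scale1r.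
rewrite !table -!scaleN1r -(lc0 x y) !(lcZ, lcD).
by congr lc; ring.
Qed.

Let br_E5 d1 d2 d3 d4 d5 d6 d7 d8 : br (E 5) (L d1 d2 d3 d4 d5 d6 d7 d8) =
  L 0 0 0 0 0 (- d1) (- (a5 - b7) * d2) (- (a6 - b8) * d2 - b7 * d3 - c * d4).
Proof.
rewrite [X in br _ X]/lc !brE (br_anti (E 1) (E 5)) (br_anti (E 2) (E 5)).
rewrite (br_anti (E 3) (E 5)) (br_anti (E 4) (E 5)).
have -> : br (E 1) (E 5) = L 0 0 0 0 0 1 0 0.
  by rewrite /lc !scale0r !add0r ?addr0 scale1r.
rewrite !table -!scaleN1r -(lc0 x y) !(lcZ, lcD).
by congr lc; ring.
Qed.

Let br_E6 d1 d2 d3 d4 d5 d6 d7 d8 : br (E 6) (L d1 d2 d3 d4 d5 d6 d7 d8) =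
  L 0 0 0 0 0 0 (- d1) (- (a5 - 2 * b7) * d2 + c * d3).
Proof.
rewrite [X in br _ X]/lc !brE (br_anti (E 1) (E 6)) (br_anti (E 2) (E 6)).
rewrite (br_anti (E 3) (E 6)) (br_anti (E 4) (E 6)) (br_anti (E 5) (E 6)).
have -> : br (E 1) (E 6) = L 0 0 0 0 0 0 1 0.
  by rewrite /lc !scale0r !add0r ?addr0 scale1r.
rewrite !table -!scaleN1r -(lc0 x y) !(lcZ, lcD).
by congr lc; ring.
Qed.

Let br_E7 d1 d2 d3 d4 d5 d6 d7 d8 : br (E 7) (L d1 d2 d3 d4 d5 d6 d7 d8) =
  L 0 0 0 0 0 0 0 (- d1 - c * d2).
Proof.
rewrite [X in br _ X]/lc !brE (br_anti (E 1) (E 7)) (br_anti (E 2) (E 7)).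
rewrite (br_anti (E 3) (E 7)) (br_anti (E 4) (E 7)) (br_anti (E 5) (E 7)).
rewrite (br_anti (E 6) (E 7)).
have -> : br (E 1) (E 7) = L 0 0 0 0 0 0 0 1.
  by rewrite /lc !scale0r !add0r ?addr0 scale1r.
rewrite !table -!scaleN1r -(lc0 x y) !(lcZ, lcD).
by congr lc; ring.
Qed.

(** This is the coordinate formula that [law8_row] reproduces for the explicit laws. *)
Lemma br_lc c1 c2 c3 c4 c5 c6 c7 c8 d1 d2 d3 d4 d5 d6 d7 d8 :
  br (L c1 c2 c3 c4 c5 c6 c7 c8) (L d1 d2 d3 d4 d5 d6 d7 d8) =
  L 0 0 (c1 * d2 - c2 * d1) (c1 * d3 - c3 * d1)
    (c1 * d4 - c4 * d1 + a5 * (c2 * d3 - c3 * d2))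
    (c1 * d5 - c5 * d1 + a6 * (c2 * d3 - c3 * d2) + a5 * (c2 * d4 - c4 * d2))
    (c1 * d6 - c6 * d1 + a7 * (c2 * d3 - c3 * d2) + a6 * (c2 * d4 - c4 * d2)
       + (a5 - b7) * (c2 * d5 - c5 * d2) + b7 * (c3 * d4 - c4 * d3))
    (c1 * d7 - c7 * d1 + a8 * (c2 * d3 - c3 * d2) + a7 * (c2 * d4 - c4 * d2)
       + (a6 - b8) * (c2 * d5 - c5 * d2) + (a5 - 2 * b7) * (c2 * d6 - c6 * d2)
       + c * (c2 * d7 - c7 * d2) + b8 * (c3 * d4 - c4 * d3)
       + b7 * (c3 * d5 - c5 * d3) - c * (c3 * d6 - c6 * d3)
       + c * (c4 * d5 - c5 * d4)).
Proof.
rewrite [X in br X]/lc.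
rewrite !(linearDl, linearZl_LR) br8l br1 br_E2 br_E3 br_E4 br_E5 br_E6 br_E7.
by rewrite -(lc0 x y) !(lcZ, lcD); congr lc; ring.
Qed.

End Table.

End AdaptedBases.

(** * Constraints imposed by a symplectic form *)

Section SymplecticConstraints.
Variables (F : numFieldType) (V : vectType F) (br : {bilinear V -> V -> V}).
Hypotheses (dimV : \dim {:V} = 8%N) (lie : is_lie_bracket br).
Variables (x y : V) (a5 a6 a7 a8 b7 b8 c : F).
Hypothesis ad : adapted br x y a5 a6 a7 a8 b7 b8 c.
Variable w : {biscalar V}.
Hypothesis w_skew : forall u v, w u v = - w v u.
Hypothesis w_nondeg : forall u, (forall v, w u v = 0) -> u = 0.
Hypothesis w_closed :
  forall u v z, w (br u v) z - w (br u z) v + w (br v z) u = 0.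
Local Notation E := (chain br x y).
Local Notation L := (lc br x y).
Local Notation W i j := (w (E i) (E j)).

Let wE := (linearDl, linearDr, linearZl_LR, linearZr_LR).
Let br8 := br_chain8 ad.

Let w_alt u : w u u = 0.
Proof.
have /eqP := w_skew u u.
by rewrite -addr_eq0 -mulr2n mulrn_eq0 /= => /eqP.
Qed.

Let w_lc c1 c2 c3 c4 c5 c6 c7 c8 v : w (L c1 c2 c3 c4 c5 c6 c7 c8) v =
  c1 * w (E 1) v + (c2 * w (E 2) v + (c3 * w (E 3) v + (c4 * w (E 4) v +
  (c5 * w (E 5) v + (c6 * w (E 6) v + (c7 * w (E 7) v + c8 * w (E 8) v)))))).
Proof. by rewrite /lc !wE. Qed.

(** Closedness with the central e_8 as one argument: e_8 is orthogonal to all brackets. *)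
Let w8_br u v : w (E 8) (br u v) = 0.
Proof.
have := w_closed u v (E 8).
by rewrite !br8 !linear0l subr0 addr0 w_skew => /eqP; rewrite oppr_eq0 => /eqP.
Qed.

Let W83 : W 8 3 = 0. Proof. exact: w8_br. Qed.
Let W84 : W 8 4 = 0. Proof. exact: w8_br. Qed.
Let W85 : W 8 5 = 0. Proof. exact: w8_br. Qed.
Let W86 : W 8 6 = 0. Proof. exact: w8_br. Qed.
Let W87 : W 8 7 = 0. Proof. exact: w8_br. Qed.

(** Closedness on e_1, e_i, e_j, read as a recursion along the lines where i + j is constant. *)
Let W_eq i j : (1 < i)%N -> (1 < j)%N ->
  W i j.+1 = - W i.+1 j - w (br (E i) (E j)) (E 1).
Proof.
case: i j => [|[|i]] [|[|j]] // _ _; have := w_closed (E 1) (E i.+2) (E j.+2).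
rewrite -[br (E 1) (E i.+2)]/(E i.+3) -[br (E 1) (E j.+2)]/(E j.+3).
rewrite (w_skew (E j.+3)) opprK => eq0.
by apply: (lincomb 1 eq0); ring.
Qed.

Let W55 : W 5 5 = 0. Proof. exact: w_alt. Qed.
Let W76 : W 7 6 = 0.
Proof.
by rewrite W_eq // W85 (br_anti lie (E 5)) (br_chain57 lie ad) !oppr0 linear0l subrr.
Qed.
Let W75 : W 7 5 = 0.
Proof.
by rewrite W_eq // W84 (br_anti lie (E 4)) (br_chain47 lie ad) !oppr0 linear0l subrr.
Qed.
Let W74 : W 7 4 = 0.
Proof.
by rewrite W_eq // W83 (br_anti lie (E 3)) (br_chain37 lie ad) !oppr0 linear0l subrr.
Qed.
Let W65 : W 6 5 = 0.
Proof.
by rewrite W_eq // W74 (br_anti lie (E 4)) (br_chain46 lie ad) !oppr0 linear0l subrr.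
Qed.

Let W64 : W 6 4 = c * W 8 1.
Proof.
rewrite w_skew (@W_eq 4 5) // W55 (br_chain45 ad) w_lc; ring.
Qed.
Let W73 : W 7 3 = - (2 * c * W 8 1).
Proof.
have := @W_eq 3 6 isT isT; rewrite (br_chain36 lie ad) w_lc w_skew.
by rewrite (w_skew (E 4)) W64 => eq; apply: (lincomb (-1) eq); ring.
Qed.
Let W82 : W 8 2 = 3 * c * W 8 1.
Proof.
have := @W_eq 2 7 isT isT; rewrite (br_chain27 lie ad) w_lc w_skew.
by rewrite (w_skew (E 3)) W73 => eq; apply: (lincomb (-1) eq); ring.
Qed.

(** Every w(e_8, e_i) is a multiple of w(e_8, e_1), so otherwise e_8 would lie in the radical. *)
Let W81_neq0 : W 8 1 != 0.
Proof.
apply: contra (chain8_neq0 ad) => /eqP W81; apply/eqP/w_nondeg => v.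
have [c1 [c2 [c3 [c4 [c5 [c6 [c7 [c8 ->]]]]]]]] :=
  lc_surj dimV lie (chain8_neq0 ad) br8 v.
by rewrite w_skew w_lc w_alt !(w_skew _ (E 8)) W87 W86 W85 W84 W83 W82 W81; ring.
Qed.

(** In the closedness relation on e_4, e_5, e_2 only w([e_4, e_5], e_2) = c w(e_8, e_2) = 3 c^2
    w(e_8, e_1) survives. *)
Lemma symplectic_c : c = 0.
Proof.
have := w_closed (E 4) (E 5) (E 2).
rewrite (br_anti lie (E 2)) (br_anti lie (E 2) (E 5)) (br_chain24 lie ad).
rewrite (br_chain25 lie ad) (br_chain45 ad) !linearNl /= !w_lc.
rewrite W55 W65 W75 W85 W74 W84 W82 => eq0.
have : 3 * c ^+ 2 * W 8 1 = 0 by apply: (lincomb 1 eq0); ring.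
by move=> /eqP; rewrite !mulf_eq0 (negPf W81_neq0) pnatr_eq0 /= orbF orbb => /eqP.
Qed.

(** The span of e_5, ..., e_8 is isotropic, so a vector in it is in the radical once it is
    orthogonal to e_4, e_3, e_2, e_1; these are the four hypotheses. *)
Let kernel_triv k5 k6 k7 k8 :
  k5 * W 5 4 = 0 -> k5 * W 5 3 + k6 * W 6 3 = 0 ->
  k5 * W 5 2 + k6 * W 6 2 + k7 * W 7 2 = 0 ->
  k5 * W 5 1 + k6 * W 6 1 + k7 * W 7 1 + k8 * W 8 1 = 0 ->
  [/\ k5 = 0, k6 = 0, k7 = 0 & k8 = 0].
Proof.
move=> eq4 eq3 eq2 eq1.
have : L 0 0 0 0 k5 k6 k7 k8 = 0.
  apply: w_nondeg => v.
  have [c1 [c2 [c3 [c4 [c5 [c6 [c7 [c8 ->]]]]]]]] :=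
    lc_surj dimV lie (chain8_neq0 ad) br8 v.
  rewrite w_skew w_lc !(w_skew _ (L _ _ _ _ _ _ _ _)) !w_lc.
  rewrite !(w_skew (E 5) (E 6), w_skew (E 5) (E 7), w_skew (E 5) (E 8)).
  rewrite !(w_skew (E 6) (E 7), w_skew (E 6) (E 8), w_skew (E 7) (E 8)).
  rewrite !w_alt W65 W75 W85 W64 W74 W84 W86 W87 W83 W73 W82 W76 symplectic_c.
  apply: (lincomb c1 eq1); apply: (lincomb c2 eq2).
  by apply: (lincomb c3 eq3); apply: (lincomb c4 eq4); ring.
by case/(lc_eq0 lie (chain8_neq0 ad) br8) => _ [].
Qed.

(* Here t = w(e_5, e_4) / w(e_8, e_1).  The matrix of [w] is triangular with respect
   to the antidiagonal, so the antidiagonal entries, which are the multiples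
   t, b_7 - t and a_5 - 3 b_7 + t of w(e_8, e_1), do not vanish. *)
Lemma symplectic_parameter : exists t,
  [/\ t * (2 * a5 + b7) = 3 * b7 ^+ 2, t != 0, t != b7 & t != 3 * b7 - a5].
Proof.
have s0 := W81_neq0.
(* If an antidiagonal entry vanished, back substitution with cleared denominators would give a
   vector in the radical. Its leading coordinate is a product of entries already known to be
   nonzero. *)
have W72 : W 7 2 != 0.
  apply/eqP => W72; have [||||_ _ s _] := @kernel_triv 0 0 (W 8 1) (- W 7 1);
    by [ring | ring | ring: W72 | ring | rewrite s eqxx in s0].
have W63 : W 6 3 != 0.
  apply/eqP => W63.
  have [||||_ s _ _] :=
    @kernel_triv 0 (W 7 2 * W 8 1) (- W 6 2 * W 8 1)
      (W 6 2 * W 7 1 - W 7 2 * W 6 1);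
    try ring; first by ring: W63.
  by move/eqP: s; rewrite mulf_eq0 (negPf W72) (negPf s0).
have W54 : W 5 4 != 0.
  apply/eqP => W54.
  pose k7 := W 5 3 * W 6 2 - W 6 3 * W 5 2.
  have [||||s _ _ _] :=
    @kernel_triv (W 6 3 * W 7 2 * W 8 1) (- W 5 3 * W 7 2 * W 8 1) (k7 * W 8 1)
      (- (W 6 3 * W 7 2 * W 5 1 - W 5 3 * W 7 2 * W 6 1 + k7 * W 7 1));
    try by rewrite /k7; ring.
    by ring: W54.
  by move/eqP: s; rewrite !mulf_eq0 (negPf W63) (negPf W72) (negPf s0).
have c0 := symplectic_c.
have eq63 := @W_eq 3 5 isT isT.
have eq72 := @W_eq 2 6 isT isT.
(* This relation becomes a_5 w(e_5, e_4) - a_5 w(e_6, e_3) + b_7 w(e_7, e_2) = 0, the source of the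
   equation for t. *)
have := w_closed (E 2) (E 3) (E 4).
rewrite (br_chain23 ad : br (E 2) (E 3) = _) (br_chain24 lie ad) (br_chain34 ad).
rewrite !w_lc W64 W74 W84 W73 W83 W82 c0.
move: eq63 eq72; rewrite (br_chain35 lie ad) (br_chain26 lie ad) !w_lc.
rewrite !(w_skew (E 3) (E 6), w_skew (E 2) (E 7), w_skew (E 4) (E 5)) => eq63 eq72 eq0.
have eq63' : W 6 3 = b7 * W 8 1 - W 5 4 by apply: (lincomb (-1) eq63); ring.
have eq72' : W 7 2 = (a5 - 3 * b7) * W 8 1 + W 5 4.
  by apply: (lincomb (-1) eq72); apply: (lincomb (-1) eq63'); ring.
have key : W 5 4 * (2 * a5 + b7) = 3 * b7 ^+ 2 * W 8 1.
  by rewrite eq63' eq72' in eq0; apply: (lincomb 1 eq0); ring.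
exists (W 5 4 / W 8 1); split.
- by rewrite mulrAC key mulfK.
- by rewrite mulf_neq0 ?invr_eq0.
- apply: contra W63 => /eqP tb; apply/eqP; rewrite eq63' -tb; field.
  exact: s0.
apply: contra W72 => /eqP tb; apply/eqP; rewrite eq72'.
have -> : W 5 4 = (3 * b7 - a5) * W 8 1 by rewrite -tb; field.
by ring.
Qed.

End SymplecticConstraints.

(** * Base changes between adapted bases, and gradings *)

Section BaseChanges.
Variables (F : numFieldType) (V : vectType F) (br : {bilinear V -> V -> V}).
Hypotheses (dimV : \dim {:V} = 8%N) (lie : is_lie_bracket br).
Variables (x y : V) (a5 a6 a7 a8 b7 b8 : F).
Hypothesis ad : adapted br x y a5 a6 a7 a8 b7 b8 0.
Local Notation E := (chain br x y).
Local Notation L := (lc br x y).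

Let lc1 : x = L 1 0 0 0 0 0 0 0.
Proof. by rewrite /lc !scale0r !addr0 scale1r. Qed.
Let lc2 : y = L 0 1 0 0 0 0 0 0.
Proof. by rewrite /lc !scale0r !addr0 add0r scale1r. Qed.
Let lc8 c : c *: E 8 = L 0 0 0 0 0 0 0 c.
Proof. by rewrite /lc !scale0r !add0r. Qed.

(** e_(i + 2) is multiplied by p^i r, hence a parameter of weight k by r / p^k. The weights are 2
    for a5 and b7, 3 for a6 and b8, 4 for a7, 5 for a8. *)
Lemma adapted_scale p r a5' a6' a7' a8' b7' b8' : p != 0 -> r != 0 ->
  a5' * p ^+ 2 = r * a5 -> a6' * p ^+ 3 = r * a6 -> a7' * p ^+ 4 = r * a7 ->
  a8' * p ^+ 5 = r * a8 -> b7' * p ^+ 2 = r * b7 -> b8' * p ^+ 3 = r * b8 ->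
  adapted br (p *: x) (r *: y) a5' a6' a7' a8' b7' b8' 0.
Proof.
move=> p0 r0 h5 h6 h7 h8 k7 k8.
have chainZ i : chain br (p *: x) (r *: y) i.+2 = (p ^+ i * r) *: E i.+2.
  elim: i => [|i IH]; first by rewrite mul1r.
  rewrite -[LHS]/(br (p *: x) (chain br (p *: x) (r *: y) i.+2)) IH.
  by rewrite linearZl_LR linearZr_LR /= !scalerA exprS mulrA.
have lcZE c5 c6 c7 c8 : lc br (p *: x) (r *: y) 0 0 0 0 c5 c6 c7 c8 =
    L 0 0 0 0 (c5 * (p ^+ 3 * r)) (c6 * (p ^+ 4 * r)) (c7 * (p ^+ 5 * r))
      (c8 * (p ^+ 6 * r)).
  by rewrite /lc !chainZ !scalerA !mul0r !scale0r.
split; rewrite ?chainZ ?lcZE.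
- by rewrite scaler_eq0 (negPf (chain8_neq0 ad)) orbF mulf_neq0 ?expf_neq0.
- by move=> v; rewrite linearZr_LR /= (br_chain8 ad) scaler0.
- rewrite linearZl_LR linearZr_LR /= (br_chain23 ad) !lcZ; congr lc; try ring.
  + by apply: (lincomb (- p * r) h5); ring.
  + by apply: (lincomb (- p * r) h6); ring.
  + by apply: (lincomb (- p * r) h7); ring.
  + by apply: (lincomb (- p * r) h8); ring.
- rewrite linearZl_LR linearZr_LR /= (br_chain34 ad) !lcZ; congr lc; try ring.
  + by apply: (lincomb (- p ^+ 3 * r) k7); ring.
  + by apply: (lincomb (- p ^+ 3 * r) k8); ring.
by rewrite linearZl_LR linearZr_LR /= (br_chain45 ad) !lcZ; congr lc; ring.
Qed.

(** Only a7 and a8 move: u can remove a7 and v can remove a8 if b7 is nonzero, and u can remove a8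
    if b7 = 0 and b8 is nonzero. *)
Lemma adapted_add_e45 u v :
  adapted br x (y + (u *: E 4 + v *: E 5)) a5 a6 (a7 - 2 * b7 * u)
    (a8 - 2 * b8 * u - 3 * b7 * v) b7 b8 0.
Proof.
set y' := y + _.
have E2 : y' = L 0 1 0 u v 0 0 0.
  by rewrite /lc !scale0r !addr0 !add0r scale1r.
pose br1 := br1_lc lie (br_chain8 ad).
have E3 : chain br x y' 3 = L 0 0 1 0 u v 0 0 by rewrite /= E2 br1.
have E4 : chain br x y' 4 = L 0 0 0 1 0 u v 0.
  by rewrite -[LHS]/(br x (chain br x y' 3)) E3 br1.
have E5 : chain br x y' 5 = L 0 0 0 0 1 0 u v.
  by rewrite -[LHS]/(br x (chain br x y' 4)) E4 br1.
have E6 : chain br x y' 6 = L 0 0 0 0 0 1 0 u.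
  by rewrite -[LHS]/(br x (chain br x y' 5)) E5 br1.
have E7 : chain br x y' 7 = L 0 0 0 0 0 0 1 0.
  by rewrite -[LHS]/(br x (chain br x y' 6)) E6 br1.
have E8 : chain br x y' 8 = L 0 0 0 0 0 0 0 1.
  by rewrite -[LHS]/(br x (chain br x y' 7)) E7 br1.
have lcE c5 c6 c7 c8 : lc br x y' 0 0 0 0 c5 c6 c7 c8 =
    c5 *: L 0 0 0 0 1 0 u v + (c6 *: L 0 0 0 0 0 1 0 u +
    (c7 *: L 0 0 0 0 0 0 1 0 + c8 *: L 0 0 0 0 0 0 0 1)).
  by rewrite {1}/lc E5 E6 E7 E8 !scale0r !add0r.
split.
- by rewrite E8 -lc8 scale1r (chain8_neq0 ad).
- by move=> z; rewrite E8 -lc8 scale1r (br_chain8 ad).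
- rewrite lcE E3 E2 (br_lc lie ad) !(lcZ, lcD); congr lc; ring.
- rewrite lcE E3 E4 (br_lc lie ad) !(lcZ, lcD); congr lc; ring.
rewrite lcE E5 E4 (br_lc lie ad) !(lcZ, lcD); congr lc; ring.
Qed.

(* c57, c58 and c68 are the e_7- and e_8-coordinates of the new e_5 and e_6. *)
Lemma adapted_add_e2 q :
  let a6' := a6 - 2 * a5 ^+ 2 * q in
  let c57 := 2 * a6 * q + (a5 - b7) * a5 * q ^+ 2 in
  let c58 := 2 * a7 * q + ((a6 - b8) * a5 + (a5 - 2 * b7) * a6) * q ^+ 2 in
  let c68 := (3 * a6 - b8) * q + (3 * a5 - 5 * b7) * a5 * q ^+ 2 in
  let a7' := a7 - a5 * c57 - a6' * (3 * a5 - b7) * q in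
  adapted br (x + q *: y) y a5 a6' a7'
    (a8 - a5 * c58 - a6' * c68 - a7' * (4 * a5 - 3 * b7) * q)
    b7 (b8 - 3 * (a5 - b7) * b7 * q) 0.
Proof.
move=> a6' c57 c58 c68 a7'.
set x' := x + _.
have E1 : x' = L 1 q 0 0 0 0 0 0.
  by rewrite /lc !scale0r !addr0 scale1r.
have br1 := br_lc lie ad 1 q 0 0 0 0 0 0.
have E3 : chain br x' y 3 = L 0 0 1 0 0 0 0 0.
  by rewrite /= {1}lc2 E1 br1; congr lc; ring.
have E4 : chain br x' y 4 = L 0 0 0 1 (a5 * q) (a6 * q) (a7 * q) (a8 * q).
  by rewrite -[LHS]/(br x' (chain br x' y 3)) E3 E1 br1; congr lc; ring.
have E5 : chain br x' y 5 = L 0 0 0 0 1 (2 * a5 * q) c57 c58.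
  by rewrite -[LHS]/(br x' (chain br x' y 4)) E4 E1 br1 /c57 /c58; congr lc; ring.
have E6 : chain br x' y 6 = L 0 0 0 0 0 1 ((3 * a5 - b7) * q) c68.
  by rewrite -[LHS]/(br x' (chain br x' y 5)) E5 E1 br1 /c57 /c68; congr lc; ring.
have E7 : chain br x' y 7 = L 0 0 0 0 0 0 1 ((4 * a5 - 3 * b7) * q).
  by rewrite -[LHS]/(br x' (chain br x' y 6)) E6 E1 br1; congr lc; ring.
have E8 : chain br x' y 8 = L 0 0 0 0 0 0 0 1.
  by rewrite -[LHS]/(br x' (chain br x' y 7)) E7 E1 br1; congr lc; ring.
have lcE c5 c6 c7 c8 : lc br x' y 0 0 0 0 c5 c6 c7 c8 =
    c5 *: L 0 0 0 0 1 (2 * a5 * q) c57 c58 +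
    (c6 *: L 0 0 0 0 0 1 ((3 * a5 - b7) * q) c68 +
    (c7 *: L 0 0 0 0 0 0 1 ((4 * a5 - 3 * b7) * q) + c8 *: L 0 0 0 0 0 0 0 1)).
  by rewrite {1}/lc E5 E6 E7 E8 !scale0r !add0r.
split.
- by rewrite E8 -lc8 scale1r (chain8_neq0 ad).
- by move=> z; rewrite E8 -lc8 scale1r (br_chain8 ad).
- by rewrite lcE E3 {1}lc2 (br_lc lie ad) !(lcZ, lcD) /a7' /a6'; congr lc; ring.
- by rewrite lcE E3 E4 (br_lc lie ad) !(lcZ, lcD); congr lc; ring.
by rewrite lcE E5 E4 (br_lc lie ad) !(lcZ, lcD); congr lc; ring.
Qed.

(* The hypotheses say that the weights 1, m, m + 1, ..., m + 6 define a grading. *)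
Lemma graded_not_charnil m :
  a5 * m = 2 * a5 -> a6 * m = 3 * a6 -> a7 * m = 4 * a7 -> a8 * m = 5 * a8 ->
  b7 * m = 2 * b7 -> b8 * m = 3 * b8 -> ~ characteristically_nilpotent br.
Proof.
move=> h5 h6 h7 h8 k7 k8 charnil.
have surj := lc_surj dimV lie (chain8_neq0 ad) (br_chain8 ad).
have /(basis_free) freeE := chain_basis dimV lie (chain8_neq0 ad) (br_chain8 ad).
(* Indices are shifted: [weight i] belongs to e_(i + 1). *)
pose weight (i : nat) : F := if i is i'.+1 then m + i'%:R else 1.
have [D0] := linear_of_free (chain_tuple br x y)
  [tuple weight i *: E i.+1 | i < 8].
rewrite !size_tuple => /(_ freeE erefl) defD.
pose D : 'End(V) := linfun D0.
have DE i : (i < 8)%N -> D (E i.+1) = weight i *: E i.+1.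
  move=> i8; have := congr1 (nth 0 ^~ i) defD.
  rewrite (nth_map 0) ?size_tuple // lfunE.
  by rewrite -(erefl : val (Ordinal i8) = i) -!tnth_nth !tnth_mktuple.
have D_lc c1 c2 c3 c4 c5 c6 c7 c8 : D (L c1 c2 c3 c4 c5 c6 c7 c8) =
    L c1 (m * c2) ((m + 1) * c3) ((m + 2) * c4) ((m + 3) * c5) ((m + 4) * c6)
      ((m + 5) * c7) ((m + 6) * c8).
  have DD u v : D (u + v) = D u + D v by exact: linearD.
  have DZ a u : D (a *: u) = a *: D u by exact: linearZ.
  rewrite /lc !DD !DZ !DE // /weight !scalerA mulr1 addr0.
  by repeat congr (_ + _); congr (_ *: _); ring.
have [|k /(_ (E 1))] := charnil D.
  move=> u v; have [c1 [c2 [c3 [c4 [c5 [c6 [c7 [c8 ->]]]]]]]] := surj u.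
  have [d1 [d2 [d3 [d4 [d5 [d6 [d7 [d8 ->]]]]]]]] := surj v.
  rewrite !D_lc !(br_lc lie ad) D_lc lcD.
  congr lc; try by ring: h5 h6.
    (* In the e_7 and e_8 coordinates the Leibniz defect is a combination of the weight relations,
       with multipliers built from the minors c_i d_j - c_j d_i. *)
    apply: (lincomb (c3 * d2 - c2 * d3) h7); apply: (lincomb (c4 * d2 - c2 * d4) h6).
    apply: (lincomb (c5 * d2 - c2 * d5) h5).
    by apply: (lincomb (c2 * d5 - c5 * d2 + c4 * d3 - c3 * d4) k7); ring.
  apply: (lincomb (c3 * d2 - c2 * d3) h8); apply: (lincomb (c4 * d2 - c2 * d4) h7).
  apply: (lincomb (c5 * d2 - c2 * d5) h6); apply: (lincomb (c6 * d2 - c2 * d6) h5).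
  apply: (lincomb (2 * (c2 * d6 - c6 * d2) + c5 * d3 - c3 * d5) k7).
  by apply: (lincomb (c2 * d5 - c5 * d2 + c4 * d3 - c3 * d4) k8); ring.
(* e_1 has weight 1, so no iterate of D kills it. *)
have -> : iter k D (E 1) = E 1.
  by elim: k => //= k ->; rewrite (DE 0) // scale1r.
rewrite /= lc1 => /(lc_eq0 lie (chain8_neq0 ad) (br_chain8 ad)) [[/eqP]].
by rewrite oner_eq0.
Qed.

End BaseChanges.

(** * From an adapted basis to an isomorphism with an explicit law *)

Section ToLaw.
Variable F : numFieldType.

Definition row8 (c1 c2 c3 c4 c5 c6 c7 c8 : F) : 'rV[F]_8 :=
  \row_i [:: c1; c2; c3; c4; c5; c6; c7; c8]`_i.

Lemma law8_row alpha c1 c2 c3 c4 c5 c6 c7 c8 d1 d2 d3 d4 d5 d6 d7 d8 :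
  law8 alpha (row8 c1 c2 c3 c4 c5 c6 c7 c8) (row8 d1 d2 d3 d4 d5 d6 d7 d8) =
  let a5 := alpha 2 5 in let a6 := alpha 2 6 in
  let a7 := alpha 2 7 in let a8 := alpha 2 8 in
  let b7 := alpha 3 7 in let b8 := alpha 3 8 in let c := alpha 4 8 in
  row8 0 0 (c1 * d2 - c2 * d1) (c1 * d3 - c3 * d1)
    (c1 * d4 - c4 * d1 + a5 * (c2 * d3 - c3 * d2))
    (c1 * d5 - c5 * d1 + a6 * (c2 * d3 - c3 * d2) + a5 * (c2 * d4 - c4 * d2))
    (c1 * d6 - c6 * d1 + a7 * (c2 * d3 - c3 * d2) + a6 * (c2 * d4 - c4 * d2)
       + (a5 - b7) * (c2 * d5 - c5 * d2) + b7 * (c3 * d4 - c4 * d3))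
    (c1 * d7 - c7 * d1 + a8 * (c2 * d3 - c3 * d2) + a7 * (c2 * d4 - c4 * d2)
       + (a6 - b8) * (c2 * d5 - c5 * d2) + (a5 - 2 * b7) * (c2 * d6 - c6 * d2)
       + c * (c2 * d7 - c7 * d2) + b8 * (c3 * d4 - c4 * d3)
       + b7 * (c3 * d5 - c5 * d3) - c * (c3 * d6 - c6 * d3)
       + c * (c4 * d5 - c5 * d4)).
Proof.
move=> /=; apply/rowP => r; rewrite !mxE.
under eq_bigr => i _ do under eq_bigr => j _ do rewrite !mxE.
(* Sums over ordinals become sums over ranges of naturals, which compute once [unlock] exposes
   them. *)
rewrite -(big_mkord xpredT (fun i => \sum_(j < 8 | (i < j)%N)
  ([:: c1; c2; c3; c4; c5; c6; c7; c8]`_i * [:: d1; d2; d3; d4; d5; d6; d7; d8]`_j -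
   [:: c1; c2; c3; c4; c5; c6; c7; c8]`_j * [:: d1; d2; d3; d4; d5; d6; d7; d8]`_i) *
  struct8 alpha i.+1 j.+1 r.+1)).
under eq_bigr => i _ do rewrite -(big_mkord (fun j => (i < j)%N) (fun j =>
  ([:: c1; c2; c3; c4; c5; c6; c7; c8]`_i * [:: d1; d2; d3; d4; d5; d6; d7; d8]`_j -
   [:: c1; c2; c3; c4; c5; c6; c7; c8]`_j * [:: d1; d2; d3; d4; d5; d6; d7; d8]`_i) *
  struct8 alpha i.+1 j.+1 r.+1)).
rewrite unlock /=.
(* One case per coordinate. The [cbv] call unfolds only arithmetic on naturals, so [ring] still
   recognises the field operations. *)
case: r => [[|[|[|[|[|[|[|[|//]]]]]]]] ?] /=;
rewrite /struct8 unlock /= /coef8 /=; 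
  cbv beta iota delta [addn muln subn Init.Nat.add Init.Nat.mul Init.Nat.sub binomial]; ring.
Qed.
End ToLaw.

(** The map sending the chain to the standard basis works, because [br_lc] and [law8_row] give the
    same formula. *)
Lemma adapted_law_isomorphic (F : numFieldType) (V : vectType F)
    (br : {bilinear V -> V -> V}) x y (alpha : nat -> nat -> F) :
  \dim {:V} = 8%N -> is_lie_bracket br ->
  adapted br x y (alpha 2 5) (alpha 2 6) (alpha 2 7) (alpha 2 8)
    (alpha 3 7) (alpha 3 8) (alpha 4 8) ->
  law_isomorphic br (law8 alpha).
Proof.
move=> dimV lie ad.
have surj := lc_surj dimV lie (chain8_neq0 ad) (br_chain8 ad).
have /(basis_free) freeE := chain_basis dimV lie (chain8_neq0 ad) (br_chain8 ad).
have [f0] := linear_of_free (chain_tuple br x y)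
  [tuple delta_mx 0 i : 'rV[F]_8 | i < 8].
rewrite !size_tuple => /(_ freeE erefl) def_f.
pose f : 'Hom(V, 'rV[F]_8) := linfun f0.
have fE i (i8 : (i < 8)%N) : f (chain br x y i.+1) = delta_mx 0 (Ordinal i8).
  have := congr1 (nth 0 ^~ i) def_f.
  rewrite (nth_map 0) ?size_tuple // lfunE.
  by rewrite -!(tnth_nth _ _ (Ordinal i8)) !tnth_mktuple.
have f_lc c1 c2 c3 c4 c5 c6 c7 c8 :
    f (lc br x y c1 c2 c3 c4 c5 c6 c7 c8) = row8 c1 c2 c3 c4 c5 c6 c7 c8.
  have fD u v : f (u + v) = f u + f v by exact: linearD.
  have fZ a u : f (a *: u) = a *: f u by exact: linearZ.
  rewrite /lc !fD !fZ !fE; apply/rowP => i; rewrite !mxE /=.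
  case: i => [[|[|[|[|[|[|[|[|//]]]]]]]] ?];
    by rewrite -!val_eqE /= ?mulr1n; ring.
exists f; split.
  pose g (r : 'rV[F]_8) := \sum_(i < 8) r 0 i *: chain br x y i.+1.
  have gE c1 c2 c3 c4 c5 c6 c7 c8 :
      g (row8 c1 c2 c3 c4 c5 c6 c7 c8) = lc br x y c1 c2 c3 c4 c5 c6 c7 c8.
    by rewrite /g !big_ord_recl big_ord0 !mxE addr0.
  exists g => [v | r].
    by have [c1 [c2 [c3 [c4 [c5 [c6 [c7 [c8 ->]]]]]]]] := surj v; rewrite f_lc gE.
  have -> : r = row8 (r 0 (inord 0)) (r 0 (inord 1)) (r 0 (inord 2)) (r 0 (inord 3))
     (r 0 (inord 4)) (r 0 (inord 5)) (r 0 (inord 6)) (r 0 (inord 7)).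
    apply/rowP => i; rewrite mxE -{1}(inord_val i).
    by case: i => [[|[|[|[|[|[|[|[|//]]]]]]]] ?].
  by rewrite gE f_lc.
move=> u v; have [c1 [c2 [c3 [c4 [c5 [c6 [c7 [c8 ->]]]]]]]] := surj u.
have [d1 [d2 [d3 [d4 [d5 [d6 [d7 [d8 ->]]]]]]]] := surj v.
by rewrite (br_lc lie ad) !f_lc law8_row.
Qed.

(** * Avoiding finitely many proper subspaces *)

(* Prime avoidance style: if [x] avoids the first [n] conditions and [y] the last
   one, then each condition holds for at most one of the vectors [x + k y]. *)
Lemma avoid_subspaces (F : numFieldType) (V : lmodType F) (P : nat -> V -> bool) n :
  (forall i a u v, P i u -> P i v -> P i (a *: u + v)) ->
  (forall i, (i < n)%N -> exists u, ~~ P i u) ->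
  exists u, forall i, (i < n)%N -> ~~ P i u.
Proof.
move=> linP; elim: n => [|n IH] nP; first by exists 0.
have PZ i a u : P i u -> P i (a *: u).
  by move=> Pu; have := linP i (a - 1) u u Pu Pu; rewrite scalerBl scale1r subrK.
have PB i u v : P i u -> P i v -> P i (u - v).
  by move=> Pu Pv; rewrite addrC -scaleN1r linP.
have [x nPx] := IH (fun i ltin => nP i (ltnW ltin)).
have [y nPy] := nP n (ltnSn n).
case: (boolP [exists k : 'I_n.+2, [forall i : 'I_n.+1, ~~ P i (x + k%:R *: y)]]).
  case/existsP=> k /forallP nPk; exists (x + k%:R *: y) => i ltin.
  exact: (nPk (Ordinal ltin)).
move=> /existsPn allP; exfalso.
have {allP} /fin_all_exists[f fP] k : exists i : 'I_n.+1, P i (x + (k : 'I_n.+2)%:R *: y).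
  by have /forallPn[i /negPn] := allP k; exists i.
(* Pigeonhole: n + 2 vectors x + k y against n + 1 conditions. A condition shared by two of them
   holds for y, hence for x. *)
have /injectivePn[k [l neq_kl eq_f]] : ~~ injectiveb f.
  apply/injectiveP => /leq_card; rewrite !card_ord ltnn //.
have Py : P (f k) y.
  have := PB _ _ _ (fP k) (eq_ind_r (fun i : 'I__ => P i _) (fP l) eq_f).
  rewrite opprD addrACA subrr add0r -scalerBl => /(PZ _ (k%:R - l%:R)^-1).
  rewrite scalerA mulVf ?scale1r // subr_eq0 eqr_nat.
  by apply: contra neq_kl => /eqP/val_inj ->.
have Px : P (f k) x.
  by have := PB _ _ _ (fP k) (PZ _ k%:R _ Py); rewrite addrK.
move: Px Py; case: (f k) => i; rewrite /= ltnS leq_eqVlt => /orP[/eqP-> _ | ltin Px _].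
  exact/negP.
by move: (nPx i ltin); rewrite Px.
Qed.

(** * Every filiform algebra of dimension 8 has an adapted basis *)

Section FiliformAdapted.
Variables (F : numFieldType) (V : vectType F) (br : {bilinear V -> V -> V}).
Hypotheses (dimV : \dim {:V} = 8%N) (lie : is_lie_bracket br).
Hypothesis fil : filiform br.
Local Notation C := (lower_central br).

Lemma br_lcs j u v : v \in C j -> br u v \in C j.+1.
Proof. by move=> Cv; rewrite br_anti // memvN memv_lie_prod // memvf. Qed.

Lemma lcs_subS j : (C j.+1 <= C j)%VS.
Proof.
elim: j => [|j IH]; first exact: subvf.
apply/lie_prod_subP => u w Cu _.
by rewrite br_anti // memvN br_lcs // (subvP IH).
Qed.

Let lcs_S j u : u \in C j.+1 -> u \in C j.
Proof. exact: (subvP (lcs_subS j)). Qed.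

Let C7 : C 7 = 0%VS.
Proof. by case: fil; rewrite dimV. Qed.

Let C6 : C 6 <> 0%VS.
Proof. by case: fil; rewrite dimV. Qed.

(** A repetition would propagate along the series and put C 6 inside C 7 = 0. *)
Let lcs_proper j : (j < 7)%N -> ~~ (C j <= C j.+1)%VS.
Proof.
move=> lt_j7; apply/negP => sCj; apply: C6.
have sub k : (C (j + k) <= C (j + k).+1)%VS.
  elim: k => [|k IH]; first by rewrite addn0.
  rewrite addnS; apply/lie_prod_subP => u w Cu _.
  by rewrite br_anti // memvN br_lcs // (subvP IH).
apply/eqP; rewrite -subv0 -C7; have := sub (6 - j)%N.
by rewrite subnKC.
Qed.

Let lcs_dim_lt j : (j < 7)%N -> (\dim (C j.+1) < \dim (C j))%N.
Proof.
move=> /lcs_proper; rewrite ltn_neqAle dimvS ?lcs_subS // andbT.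
by apply: contra => eq_dim; rewrite -(geq_leqif (dimv_leqif_sup (lcs_subS j))) (eqP eq_dim).
Qed.

(* Otherwise [V] is spanned by some [x] and [C 1], and then
   [C 1] = [V, V] lies in [C 2] because [x, x] = 0. *)
Let lcs_dim1 : (\dim (C 1) <= 6)%N.
Proof.
rewrite leqNgt; apply/negP => dim1.
have /subvPn[x _ xC1] := lcs_proper (isT : (0 < 7)%N).
have full : (<[x]> + C 1)%VS = fullv.
  apply/eqP; rewrite eqEdim subvf /= dimV ltnNge; apply/negP => dimS.
  have : (<[x]> + C 1 <= C 1)%VS.
    rewrite -(geq_leqif (dimv_leqif_sup (addvSr <[x]> (C 1)))).
    exact: leq_trans dimS dim1.
  by move/subvP/(_ x); rewrite (negPf xC1) (subvP (addvSl _ _)) ?memv_line // => /(_ isT).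
move: (lcs_proper (isT : (1 < 7)%N)) => /negP[].
apply/lie_prod_subP => u w _ _.
have /memv_addP[_ /vlineP[a ->] [u' Cu' ->]] : u \in (<[x]> + C 1)%VS by rewrite full memvf.
have /memv_addP[_ /vlineP[b ->] [w' Cw' ->]] : w \in (<[x]> + C 1)%VS by rewrite full memvf.
rewrite linearDl rpredD //; last by rewrite br_anti // memvN br_lcs.
rewrite linearDr rpredD //; last exact: br_lcs.
by rewrite linearZl_LR linearZr_LR /= br_alt // !scaler0 mem0v.
Qed.

(** There are six strict drops from dimension at most 6 at C 1 to 0 at C 7, so each is by exactly
    one. *)
Let lcs_dim j : (0 < j < 7)%N -> \dim (C j) = (\dim (C j.+1)).+1.
Proof.
have := lcs_dim1; have := dimv0 V; rewrite -C7.
have := lcs_dim_lt (isT : (1 < 7)%N); have := lcs_dim_lt (isT : (2 < 7)%N).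
have := lcs_dim_lt (isT : (3 < 7)%N); have := lcs_dim_lt (isT : (4 < 7)%N).
have := lcs_dim_lt (isT : (5 < 7)%N); have := lcs_dim_lt (isT : (6 < 7)%N).
by case: j => [|[|[|[|[|[|[|]]]]]]] //; lia.
Qed.

Let lcs_decomp j e v : (0 < j < 7)%N -> e \in C j -> e \notin C j.+1 -> v \in C j ->
  exists a, v - a *: e \in C j.+1.
Proof.
move=> lt_j7 Ce nCe Cv.
have full : (<[e]> + C j.+1)%VS = C j.
  apply/eqP; rewrite eqEdim subv_add -memvE Ce lcs_subS /= lcs_dim // ltnNge.
  apply/negP => dimS.
  have : (<[e]> + C j.+1 <= C j.+1)%VS.
    by rewrite -(geq_leqif (dimv_leqif_sup (addvSr <[e]> (C j.+1)))).
  move/subvP/(_ e); rewrite (negPf nCe) (subvP (addvSl _ _)) ?memv_line //.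
  by move/(_ isT).
move: Cv; rewrite -full => /memv_addP[_ /vlineP[a ->] [v' Cv' ->]].
by exists a; rewrite addrAC subrr add0r.
Qed.

(** For each j the z with [z, C j] inside C (j + 2) form a subspace. It is proper, since otherwise C
    (j + 1) would lie in C (j + 2); x avoids all six. *)
Let generic_vector : exists x, forall j, (j < 6)%N ->
  exists2 u, u \in C j & br x u \notin C j.+2.
Proof.
pose P j z := all (fun u => br z u \in C j.+2) (vbasis (C j)).
have PP j z : reflect (forall u, u \in C j -> br z u \in C j.+2) (P j z).
  apply: (iffP allP) => Pz u Cu; last by apply: Pz; apply: vbasis_mem.
  rewrite (coord_vbasis Cu) linear_sumr memv_suml // => i _.
  by rewrite linearZr_LR memvZ // Pz // mem_nth // size_tuple.
have [|j ltj6|x nPx] := @avoid_subspaces _ _ P 6.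
- move=> j a z t /PP Pz /PP Pt; apply/PP => u Cu.
  by rewrite linearDl linearZl_LR rpredD ?memvZ ?Pz ?Pt.
- have := lcs_proper (ltj6 : (j.+1 < 7)%N).
  have [/allP Pall | /allPn[z _ nPz] _] := boolP (all (P j) (vbasis fullv));
    last by exists z.
  case/negP; apply/lie_prod_subP => u w Cu _; rewrite br_anti // memvN.
  rewrite (coord_vbasis (memvf w)) linear_sumlz memv_suml // => i _.
  rewrite linearZl_LR memvZ //; apply: (elimT (PP _ _)) Cu.
  by apply: Pall; rewrite mem_nth // size_tuple.
exists x => j ltj6; have := nPx j ltj6; rewrite -has_predC => /hasP[u Cu nCu].
by exists u => //; apply: vbasis_mem.
Qed.

Lemma filiform_adapted : exists x y a5 a6 a7 a8 b7 b8 c,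
  adapted br x y a5 a6 a7 a8 b7 b8 c.
Proof.
have [x gen] := generic_vector.
have [y0 _ nC2] := gen 0%N isT.
(* e_(i + 2) spans C i modulo C (i + 1). Inductively, the u supplied by [gen] is a multiple of the
   chain vector modulo the next term, so [x, u] could not escape if the next chain vector did
   not. *)
have chainC y : br x y \notin C 2 -> forall i, (0 < i < 7)%N ->
    (chain br x y i.+2 \in C i) && (chain br x y i.+2 \notin C i.+1).
  move=> nCy; elim=> // i IH; case: i IH => [_ _|i IH lt_i7].
    by apply/andP; split; [exact: (@br_lcs 0 x y (memvf y)) | exact: nCy].
  have /andP[Ce nCe] := IH (ltnW lt_i7).
  rewrite -[chain _ _ _ _]/(br x (chain br x y i.+3)) br_lcs // andTb.
  have [u Cu nCu] := gen i.+1 lt_i7.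
  have [a Ca] := lcs_decomp (ltnW lt_i7 : (0 < i.+1 < 7)%N) Ce nCe Cu.
  apply: contra nCu => Cxe; rewrite -(subrK (a *: chain br x y i.+3) u).
  by rewrite linearDr linearZr_LR; apply: rpredD; [exact: br_lcs | exact: memvZ].
have /andP[C3 _] := chainC _ nC2 1%N isT.
have /andP[C4 nC4] := chainC _ nC2 2%N isT.
have [b Cb] := lcs_decomp (isT : (0 < 2 < 7)%N) C4 nC4 (br_lcs y0 C3).
(* Subtracting b x removes the e_4 coordinate of [e_2, e_3] and leaves e_3, e_4, ... unchanged. *)
pose y := y0 - b *: x.
have xy : br x y = br x y0.
  by rewrite linearBr linearZr_LR /= br_alt // scaler0 subr0.
have C23 : br y (chain br x y 3) \in C 3.
  by rewrite /= xy linearBl linearZl_LR.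
have nCy : br x y \notin C 2 by rewrite xy.
have {chainC} chC := chainC _ nCy.
have [{}C3 nC3] := andP (chC 1%N isT); have [{}C4 {}nC4] := andP (chC 2%N isT).
have [C5 nC5] := andP (chC 3%N isT); have [C6' nC6] := andP (chC 4%N isT).
have [C7' nC7] := andP (chC 5%N isT); have [C8 nC8] := andP (chC 6%N isT).
have lcs6 v : v \in C 6 -> exists c, v = lc br x y 0 0 0 0 0 0 0 c.
  move=> /(@lcs_decomp 6 _ v isT C8 nC8)[c]; rewrite C7 memv0 subr_eq0 => /eqP ->.
  by exists c; rewrite /lc !scale0r !add0r.
have lcs5 v : v \in C 5 -> exists c7 c8, v = lc br x y 0 0 0 0 0 0 c7 c8.
  move=> /(@lcs_decomp 5 _ v isT C7' nC7)[c7 /lcs6[c8 /eqP]]; rewrite subr_eq => /eqP ->.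
  exists c7, c8; by rewrite addrC /lc !scale0r !add0r.
have lcs4 v : v \in C 4 -> exists c6 c7 c8, v = lc br x y 0 0 0 0 0 c6 c7 c8.
  move=> /(@lcs_decomp 4 _ v isT C6' nC6)[c6 /lcs5[c7 [c8 /eqP]]].
  rewrite subr_eq => /eqP ->.
  exists c6, c7, c8; by rewrite addrC /lc !scale0r !add0r.
have lcs3 v : v \in C 3 -> exists c5 c6 c7 c8, v = lc br x y 0 0 0 0 c5 c6 c7 c8.
  move=> /(@lcs_decomp 3 _ v isT C5 nC5)[c5 /lcs4[c6 [c7 [c8 /eqP]]]].
  rewrite subr_eq => /eqP ->.
  exists c5, c6, c7, c8; by rewrite addrC /lc !scale0r !add0r.
(* By the Jacobi identity ad e_3 and ad e_4 move the series by two and three steps, which confines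
   [e_3, e_4] to C 4 and [e_4, e_5] to C 6. *)
have ad3 j u v : v \in C j -> br (br x u) v \in C j.+2.
  move=> Cv; have -> : br (br x u) v = br x (br u v) - br u (br x v).
    by rewrite (br_leibniz lie x u v) addrK.
  by rewrite rpredB // !br_lcs.
have ad4 j u v : v \in C j -> br (br x (br x u)) v \in C j.+3.
  move=> Cv; rewrite (_ : br _ v = br x (br (br x u) v) - br (br x u) (br x v)); last first.
    by rewrite (br_leibniz lie x _ v) addrK.
  by rewrite rpredB ?(ad3 _ _ _ (br_lcs _ _)) // br_lcs // ad3.
have br8 v : br v (chain br x y 8) = 0.
  by apply/eqP; rewrite -memv0 -C7 br_lcs.
have nz8 : chain br x y 8 != 0 by apply: contra nC8 => /eqP->; rewrite mem0v.
have [a5 [a6 [a7 [a8 t23]]]] := lcs3 _ C23.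
have [b6 [b7 [b8 t34]]] :=
  lcs4 _ (ad3 _ y _ C4 : br (chain br x y 3) (chain br x y 4) \in C 4).
have [c t45] :=
  lcs6 _ (ad4 _ y _ C5 : br (chain br x y 4) (chain br x y 5) \in C 6).
(* The e_7-coordinate of the Jacobi identity for e_2, e_3, e_4 is -2 b6^2. *)
suff b6_0 : b6 = 0.
  by exists x, y, a5, a6, a7, a8, b7, b8, c; split; rewrite // t34 b6_0.
have br1 := br1_lc lie br8.
have t24 : br (chain br x y 2) (chain br x y 4) = lc br x y 0 0 0 0 0 a5 a6 a7.
  by rewrite br_chainS // t23 br1 br_alt // subr0.
have t25 : br (chain br x y 2) (chain br x y 5) =
    lc br x y 0 0 0 0 0 (- b6) (a5 - b7) (a6 - b8).
  by rewrite br_chainS // t24 br1 t34 lcB !subr0 sub0r.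
have t35 : br (chain br x y 3) (chain br x y 5) = lc br x y 0 0 0 0 0 0 b6 b7.
  by rewrite br_chainS // t34 br1 br_alt // subr0.
have t26 : br (chain br x y 2) (chain br x y 6) =
    lc br x y 0 0 0 0 0 0 (- 2 * b6) (a5 - 2 * b7).
  by rewrite br_chainS // t25 br1 t35 lcB; congr lc; ring.
have key k : k *: chain br x y 7 \in C 6 -> k = 0.
  move=> Ck; apply/eqP; apply: contraR nC7 => k0.
  by rewrite -(scalerK k0 (chain br x y 7)) memvZ.
have := br_leibniz lie (chain br x y 2) (chain br x y 3) (chain br x y 4).
(* Two of the Jacobi terms lie in C 6, the line of e_8, so the third has no e_7 coordinate
   either. *)
have Cr : br (br (chain br x y 2) (chain br x y 3)) (chain br x y 4) +
  br (chain br x y 3) (br (chain br x y 2) (chain br x y 4)) \in C 6.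
  apply: rpredD; first by rewrite br_anti // memvN ad4.
  have C7S := lcs_S C7'; have C8S := lcs_S (lcs_S C8).
  apply: (ad3 4%N); rewrite t24 /lc !scale0r !add0r.
  by apply: rpredD; [exact: memvZ | apply: rpredD; exact: memvZ].
move=> eqJ; rewrite -{}eqJ t34 /lc !scale0r !add0r in Cr.
rewrite !linearDr !linearZr_LR br8 scaler0 addr0 in Cr.
have C27 : b7 *: br (chain br x y 2) (chain br x y 7) \in C 6 by rewrite memvZ // br_lcs.
move: Cr; rewrite rpredDr // t26 /lc !scale0r !add0r scalerDr !scalerA.
rewrite (rpredDr _ (memvZ _ C8)) => /key /eqP.
by rewrite !mulf_eq0 oppr_eq0 pnatr_eq0 /= orbb => /eqP.
Qed.

End FiliformAdapted.

(** * Normal forms in the four cases *)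

Section Classification.
Variables (F : numFieldType) (V : vectType F) (br : {bilinear V -> V -> V}).
Hypotheses (dimV : \dim {:V} = 8%N) (lie : is_lie_bracket br).
Hypothesis charnil : characteristically_nilpotent br.

Let n2 : (2 : F) != 0. Proof. by rewrite pnatr_eq0. Qed.
Let n3 : (3 : F) != 0. Proof. by rewrite pnatr_eq0. Qed.

Let psiE := (mulr0, mulr1, addr0, add0r).

Lemma classify_b7_neq0 x y a5 a6 a7 a8 b7 b8 :
  adapted br x y a5 a6 a7 a8 b7 b8 0 -> a5 != 0 -> b7 != 0 ->
  law_isomorphic br
    (law8 (fun k s => a5 / b7 * psi 2 5 k s + psi 3 7 k s + psi 3 8 k s)).
Proof.
move=> ad a50 b70.
(* This q kills a6; the change of e_2 then kills a7 and a8. *)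
have := adapted_add_e2 lie ad (a6 / (2 * a5 ^+ 2)).
set x' := x + _ *: y => /=; set a7' := a7 - _ - _; set a8' := a8 - _ - _ - _.
set b8' := b8 - _.
have -> : a6 - 2 * a5 ^+ 2 * (a6 / (2 * a5 ^+ 2)) = 0 by field.
move=> {}ad; pose u := a7' / (2 * b7).
have := adapted_add_e45 lie ad u ((a8' - 2 * b8' * u) / (3 * b7)).
have -> : a7' - 2 * b7 * u = 0 by rewrite /u; field.
have -> : a8' - 2 * b8' * u - 3 * b7 * ((a8' - 2 * b8' * u) / (3 * b7)) = 0.
  by field.
set y' := y + _ => {}ad.
have b8'0 : b8' != 0.
  apply/eqP => b8'0; apply: (graded_not_charnil dimV lie ad (m := 2)) charnil;
    by rewrite ?b8'0; ring.
(* The unique solution of p^2 = r b7 and p^3 = r b8', which makes both b-parameters 1. *)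
pose p := b8' / b7; pose r := p ^+ 2 / b7.
have p0 : p != 0 by rewrite mulf_neq0 ?invr_eq0.
apply: (adapted_law_isomorphic (x := p *: x') (y := r *: y') dimV lie).
rewrite /psi /= !psiE.
apply: (adapted_scale ad) => //; rewrite ?mulf_neq0 ?invr_eq0 ?expf_neq0 //;
  by rewrite /r /p; field.
Qed.

Lemma classify_b8_neq0 x y a6 a7 a8 b8 :
  adapted br x y 0 a6 a7 a8 0 b8 0 -> b8 != 0 ->
  law_isomorphic br
    (law8 (fun k s => a6 / b8 * psi 2 6 k s + psi 2 7 k s + psi 3 8 k s)).
Proof.
move=> ad b80.
have := adapted_add_e45 lie ad (a8 / (2 * b8)) 0.
have -> : a8 - 2 * b8 * (a8 / (2 * b8)) - 3 * 0 * 0 = 0 by field.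
have -> : a7 - 2 * 0 * (a8 / (2 * b8)) = a7 by rewrite mulr0 mul0r subr0.
set y' := y + _ => {}ad.
have a70 : a7 != 0.
  apply/eqP => a70; apply: (graded_not_charnil dimV lie ad (m := 3)) charnil;
    by rewrite ?a70; ring.
(* Solves p^3 = r b8 and p^4 = r a7. *)
pose p := a7 / b8; pose r := p ^+ 3 / b8.
have p0 : p != 0 by rewrite mulf_neq0 ?invr_eq0.
apply: (adapted_law_isomorphic (x := p *: x) (y := r *: y') dimV lie).
rewrite /psi /= !psiE.
apply: (adapted_scale ad) => //; rewrite ?mulf_neq0 ?invr_eq0 ?expf_neq0 //;
  by rewrite /r /p; field.
Qed.

(** With b7 = b8 = 0 a change of e_2 no longer moves a8, but e_1 + q e_2 changes it by -3 a6^2 q and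
    fixes the other parameters. *)
Lemma classify_a6_neq0 x y a6 a7 a8 :
  adapted br x y 0 a6 a7 a8 0 0 0 -> a6 != 0 ->
  law_isomorphic br (law8 (fun k s => psi 2 6 k s + psi 2 7 k s)).
Proof.
move=> ad a60.
have := adapted_add_e2 lie ad (a8 / (3 * a6 ^+ 2)).
set x' := x + _ *: y => /=; set a6' := a6 - _; set a7' := a7 - _ - _.
set a8' := a8 - _ - _ - _; set b8' := 0 - _.
have -> : b8' = 0 by rewrite /b8'; ring.
have -> : a8' = 0 by rewrite /a8' /a7' /a6'; field.
have -> : a7' = a7 by rewrite /a7'; ring.
have -> : a6' = a6 by rewrite /a6'; ring.
move=> {}ad.
have a70 : a7 != 0.
  apply/eqP => a70; apply: (graded_not_charnil dimV lie ad (m := 3)) charnil;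
    by rewrite ?a70; ring.
pose p := a7 / a6; pose r := p ^+ 3 / a6.
have p0 : p != 0 by rewrite mulf_neq0 ?invr_eq0.
apply: (adapted_law_isomorphic (x := p *: x') (y := r *: y) dimV lie).
rewrite /psi /= !psiE.
apply: (adapted_scale ad) => //; rewrite ?mulf_neq0 ?invr_eq0 ?expf_neq0 //;
  by rewrite /r /p; field.
Qed.

(** If a7 or a8 vanishes, the other one alone is compatible with a grading, by m = 5 or m = 4. *)
Lemma classify_a6_eq0 x y a7 a8 :
  adapted br x y 0 0 a7 a8 0 0 0 ->
  law_isomorphic br (law8 (fun k s => psi 2 7 k s + psi 2 8 k s)).
Proof.
move=> ad.
have a70 : a7 != 0.
  apply/eqP => a70; apply: (graded_not_charnil dimV lie ad (m := 5)) charnil;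
    by rewrite ?a70; ring.
have a80 : a8 != 0.
  apply/eqP => a80; apply: (graded_not_charnil dimV lie ad (m := 4)) charnil;
    by rewrite ?a80; ring.
pose p := a8 / a7; pose r := p ^+ 4 / a7.
have p0 : p != 0 by rewrite mulf_neq0 ?invr_eq0.
apply: (adapted_law_isomorphic (x := p *: x) (y := r *: y) dimV lie).
rewrite /psi /= !psiE.
apply: (adapted_scale ad) => //; rewrite ?mulf_neq0 ?invr_eq0 ?expf_neq0 //;
  by rewrite /r /p; field.
Qed.

End Classification.

Theorem corollary3p10 (R : realType) (V : vectType R[i])
    (br : {bilinear V -> V -> V}) :
  \dim {:V} = 8%N ->
  is_lie_bracket br ->
  filiform br ->
  symplectic br ->
  characteristically_nilpotent br ->
  [\/ exists a : R[i],
        [/\ a <> - (1 / 2%:R), a <> 0, a <> 1 & a <> 5%:R / 2%:R] /\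
        law_isomorphic br
          (law8 (fun k s => a * psi 2 5 k s + psi 3 7 k s + psi 3 8 k s)),
      exists a : R[i],
        law_isomorphic br
          (law8 (fun k s => a * psi 2 6 k s + psi 2 7 k s + psi 3 8 k s)),
      law_isomorphic br
        (law8 (fun k s => psi 2 7 k s + psi 2 8 k s)) |
      law_isomorphic br
        (law8 (fun k s => psi 2 6 k s + psi 2 7 k s))].
Proof.
move=> dimV lie fil [w [w_skew w_nondeg w_closed]] charnil.
have [x [y [a5 [a6 [a7 [a8 [b7 [b8 [c ad]]]]]]]]] := filiform_adapted dimV lie fil.
have c0 := symplectic_c dimV lie ad w_skew w_nondeg w_closed; subst c.
have [t [eq_t t0 tb7 tw]] := symplectic_parameter dimV lie ad w_skew w_nondeg w_closed.
have n2 : (2 : R[i]) != 0 by rewrite pnatr_eq0.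
have n3 : (3 : R[i]) != 0 by rewrite pnatr_eq0.
have [b70 | b70] := eqVneq b7 0; last first.
  have a5E : a5 = a5 / b7 * b7 by rewrite divfK.
  (* Division by b7 turns the relation into one for the ratio a = a5 / b7. *)
  have {}eq_t : t * (2 * (a5 / b7) + 1) = 3 * b7.
    by apply: (mulIf b70); apply: (lincomb 1 eq_t); field.
  have a_neq0 : a5 / b7 != 0.
    apply: contra tw => /eqP a0; rewrite a5E a0; rewrite a0 in eq_t.
    by apply/eqP; apply: (lincomb 1 eq_t); ring.
  constructor 1; exists (a5 / b7); split; last first.
    apply: (classify_b7_neq0 dimV lie charnil ad) => //.
    by apply: contra a_neq0 => /eqP->; rewrite mul0r.
  (* The value -1/2 gives b7 = 0, the value 1 gives t = b7, and 5/2 gives t = b7 / 2 = 3 b7 - a5;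
     the value 0, excluded above, gives t = 3 b7 = 3 b7 - a5. *)
  split=> [a_eq | /eqP | a_eq | a_eq]; rewrite ?a_eq in eq_t.
  - case/negP: b70; apply/eqP/(mulfI n3).
    by apply: (lincomb (-1) eq_t); field.
  - by rewrite (negPf a_neq0).
  - by case/negP: tb7; apply/eqP/(mulfI n3); apply: (lincomb 1 eq_t); ring.
  case/negP: tw; rewrite a5E a_eq; apply/eqP/(mulfI (mulf_neq0 n2 n3)).
  by apply: (lincomb 1 eq_t); field.
subst b7.
(* For b7 = 0 the relation reads 2 t a5 = 0 with t nonzero. *)
have a50 : a5 = 0.
  move/eqP: eq_t; rewrite addr0 expr0n mulr0 !mulf_eq0 (negPf t0) (negPf n2) /=.
  by move/eqP.
subst a5.
have [b80 | b80] := eqVneq b8 0; last first.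
  by constructor 2; exists (a6 / b8); apply: classify_b8_neq0 ad b80.
subst b8; have [a60 | a60] := eqVneq a6 0; last first.
  by constructor 4; apply: classify_a6_neq0 ad a60.
by constructor 3; subst a6; apply: classify_a6_eq0 ad.
Qed.
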